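(* Let $\mathcal V,\mathcal W,a_\varepsilon,f_\varepsilon,J_\varepsilon,u_\varepsilon,p_\varepsilon,j,\mathcal L$ be as in the context. (i) Let $\ell_1:\mathbb R^+\to\mathbb R^+$ with $\lim_{\varepsilon\searrow0}\ell_1(\varepsilon)=0$, and assume that the limits $$\mathcal R^{(1)}:=\lim_{\varepsilon\searrow0}\frac{\mathcal L(\varepsilon,u_\varepsilon,p_\varepsilon)-\mathcal L(\varepsilon,u_0,p_\varepsilon)}{\ell_1(\varepsilon)},\qquad \partial^{(1)}_\ell\mathcal L:=\lim_{\varepsilon\searrow0}\frac{\mathcal L(\varepsilon,u_0,p_\varepsilon)-\mathcal L(0,u_0,p_\varepsilon)}{\ell_1(\varepsilon)}$$ exist. Then $j(\varepsilon)=j(0)+\ell_1(\varepsilon)(\mathcal R^{(1)}+\partial^{(1)}_\ell\mathcal L)+o(\ell_1(\varepsilon))$ as $\varepsilon\searrow0$. In particular, if there are numbers $\delta a^{(1)},\delta f^{(1)},\delta J^{(1)}_1,\delta J^{(1)}_2$ with $$(a_\varepsilon-a_0)(u_0,p_\varepsilon)=\ell_1(\varepsilon)\delta a^{(1)}+o(\ell_1(\varepsilon)),\qquad (f_\varepsilon-f_0)(p_\varepsilon)=\ell_1(\varepsilon)\delta f^{(1)}+o(\ell_1(\varepsilon)),$$ $$J_\varepsilon(u_\varepsilon)=J_\varepsilon(u_0)+\partial J_\varepsilon(u_0)(u_\varepsilon-u_0)+\ell_1(\varepsilon)\delta J_1^{(1)}+o(\ell_1(\varepsilon)),\qquad J_\varepsilon(u_0)=J_0(u_0)+\ell_1(\varepsilon)\delta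 J^{(1)}_2+o(\ell_1(\varepsilon)),$$ then $\mathcal R^{(1)}+\partial^{(1)}_\ell\mathcal L=\delta a^{(1)}-\delta f^{(1)}+\delta J_1^{(1)}+\delta J_2^{(1)}$. (ii) Let $\ell_2:\mathbb R^+\to\mathbb R^+$ with $\lim_{\varepsilon\searrow0}\ell_2(\varepsilon)/\ell_1(\varepsilon)=0$. Assume that the assumptions in (i) (existence of the limits $\mathcal R^{(1)},\partial_\ell^{(1)}\mathcal L$) hold and that the limits $$\mathcal R^{(2)}:=\lim_{\varepsilon\searrow0}\frac{\mathcal L(\varepsilon,u_\varepsilon,p_\varepsilon)-\mathcal L(\varepsilon,u_0,p_\varepsilon)-\ell_1(\varepsilon)\mathcal R^{(1)}}{\ell_2(\varepsilon)},\qquad \partial^{(2)}_\ell\mathcal L:=\lim_{\varepsilon\searrow0}\frac{\mathcal L(\varepsilon,u_0,p_\varepsilon)-\mathcal L(0,u_0,p_\varepsilon)-\ell_1(\varepsilon)\partial^{(1)}_\ell\mathcal L}{\ell_2(\varepsilon)}$$ exist. Then $j(\varepsilon)=j(0)+\ell_1(\varepsilon)(\mathcal R^{(1)}+\partial^{(1)}_\ell\mathcal L)+\ell_2(\varepsilon)(\mathcal R^{(2)}+\partial^{(2)}_\ell\mathcal L)+o(\ell_2(\varepsilon))$.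
   Context: $\mathcal V,\mathcal W$ are real Hilbert spaces. For all small $\varepsilon\ge0$, $a_\varepsilon$ is a bilinear form on $\mathcal V\times\mathcal W$, $f_\varepsilon$ a linear form on $\mathcal W$, and $u_\varepsilon\in\mathcal V$ is the unique solution of $a_\varepsilon(u_\varepsilon,\varphi)=f_\varepsilon(\varphi)$ for all $\varphi\in\mathcal W$; it is assumed that $u_\varepsilon-u_0\in\mathcal W$ for all $\varepsilon$ (so $u_\varepsilon-u_0$ lies in both $\mathcal V$ and $\mathcal W$). $J_\varepsilon:\mathcal V\to\mathbb R$ is differentiable at $u_0$ for every $\varepsilon\ge0$, and $j(\varepsilon)=J_\varepsilon(u_\varepsilon)$. The Lagrangian is $\mathcal L(\varepsilon,u,v)=J_\varepsilon(u)+a_\varepsilon(u,v)-f_\varepsilon(v)$ for $u\in\mathcal V$, $v\in\mathcal W$. The adjoint state $p_\varepsilon\in\mathcal W$ is assumed to exist and satisfies $a_\varepsilon(\varphi,p_\varepsilon)=-\partial J_\varepsilon(u_0)(\varphi)$ for all $\varphi\in\mathcal V$. *)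

(* Defs.v *)
From HB Require Import structures.
From mathcomp Require Import all_boot all_order all_algebra.
From mathcomp Require Export sesquilinear.
From mathcomp Require Export all_classical all_reals all_analysis.

Set Implicit Arguments.
Unset Strict Implicit.
Unset Printing Implicit Defensive.

Import Order.TTheory GRing.Theory Num.Theory.
Import numFieldNormedType.Exports.

Local Open Scope ring_scope.

(* The inner product is recovered from the norm by polarization, so it is
   enough to assert its existence; completeness is part of the carrier type. *)
Definition is_hilbert (R : realType) (V : completeNormedModType R) : Prop :=
  exists ip : {dot V for @idfun R}, forall x : V, `|x| ^+ 2 = ip x x.

Definition lagrangian (R : realType) (V W : Type) (J : R -> V -> R)
    (a : R -> V -> W -> R) (f : R -> W -> R) (e : R) (u : V) (v : W) : R :=
  J e u + a e u v - f e v.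

Definition reduced_cost (R : realType) (V : Type) (J : R -> V -> R)
    (u : R -> V) (e : R) : R := J e (u e).

(* Main.v *)
(* Both states cancel the residual of the Lagrangian: L(e, u_e, p_e) = J_e(u_e)
   and L(0, u_0, p_e) = J_0(u_0), so j(e) - j(0) is the sum of the two Lagrangian
   differences. For the formula in (i), the adjoint equation turns
   dJ_e(u_0)(u_e - u_0) into a_e(u_0, p_e) - f_e(p_e), and limits are unique. *)
Require Import Defs.
From mathcomp Require Import all_boot all_order all_algebra ring.
From mathcomp Require Import all_classical all_reals all_analysis.

Import Order.TTheory GRing.Theory Num.Theory.
Import numFieldNormedType.Exports.

Local Open Scope classical_set_scope.
Local Open Scope ring_scope.

(* The left-hand equation is asserted at every e, also at e <= 0: landau takes
   g - h itself as the remainder, and the little-o condition concerns only its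
   germ at 0^'+. *)
Lemma eqaddo_right_cvgP (R : realType) (l g h : R -> R) :
  (forall e, 0 < e -> 0 < l e) ->
  (forall e, g e = h e +o_(e \near 0^'+) (l e)) <->
  (g e - h e) / l e @[e --> 0^'+] --> 0.
Proof.
move=> l_gt0; split=> [gh|gh].
- have /eqaddoP gho : g = h +o_ (0^'+) l by exact: eqaddoE (funext gh).
  (* As [l e] is nonzero to the right of 0, bounding the quotient by [eps] is the little-o estimate
     with the same [eps]. *)
  apply/cvgr0Pnorm_le => eps eps_gt0; near=> e.
  have le_gt0 : 0 < l e by apply: l_gt0; near: e; exact: nbhs_right_gt.
  rewrite normrM normfV ler_pdivrMr ?normr_gt0 ?gt_eqF//.
  by near: e; exact: gho.
- suff gho : g = h +o_ (0^'+) l by apply: eqaddoEx => e; rewrite {1}gho.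
  apply/eqaddoP => eps eps_gt0; near=> e.
  have le_gt0 : 0 < l e by apply: l_gt0; near: e; exact: nbhs_right_gt.
  rewrite -ler_pdivrMr ?normr_gt0 ?gt_eqF// -normfV -normrM.
  by near: e; move/cvgr0Pnorm_le : gh; apply.
Unshelve. all: by end_near. Qed.

(** Where [l e] is nonzero, the first quotient is [g e / l e - c]; this is guaranteed only for
    [e > 0], hence the passage through germs at [0^'+]. *)
Lemma cvg_right_div_subP (R : realType) (l g : R -> R) (c : R) :
  (forall e, 0 < e -> 0 < l e) ->
  (g e - l e * c) / l e @[e --> 0^'+] --> 0 <-> g e / l e @[e --> 0^'+] --> c.
Proof.
move=> l_gt0; rewrite -(subr_cvg0 (fun e => g e / l e)).
have subE : {near 0^'+, (fun e => (g e - l e * c) / l e)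
    =1 (fun e => g e / l e - c)}.
  near=> e; have le_gt0 : 0 < l e by apply: l_gt0; near: e; exact: nbhs_right_gt.
  by field; rewrite gt_eqF.
split; apply: cvg_trans; apply: near_eq_cvg => //.
by apply: filterS subE => e ->.
Unshelve. all: by end_near. Qed.

(** Translates between expansions and limits of difference quotients, so that expansions can be
    added and compared as limits. *)
Lemma eqaddo_scale_right_cvgP (R : realType) (l g h : R -> R) (c : R) :
  (forall e, 0 < e -> 0 < l e) ->
  (forall e, g e = (h e + l e * c) +o_(e \near 0^'+) (l e)) <->
  (g e - h e) / l e @[e --> 0^'+] --> c.
Proof.
move=> l_gt0; rewrite -(cvg_right_div_subP _ _ (fun e => g e - h e) c l_gt0).
rewrite (eqaddo_right_cvgP _ _ _ (fun e => h e + l e * c) l_gt0).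
by under eq_fun do rewrite opprD addrA.
Qed.

Theorem proposition2p2 (R : realType) (V W : completeNormedModType R)
  (hV : is_hilbert V) (hW : is_hilbert W)
  (* V and W as subspaces of a common vector space, so that membership of
     u_e - u_0 in both makes sense *)
  (E : lmodType R) (iV : {linear V -> E}) (iW : {linear W -> E})
  (iV_inj : injective iV) (iW_inj : injective iW)
  (e0 : R) (e0_gt0 : 0 < e0)
  (a : R -> V -> W -> R) (f : R -> W -> R) (J : R -> V -> R)
  (u : R -> V) (p : R -> W)
  (a_bilin : forall e, 0 <= e < e0 -> bilinear_for *%R *%R (a e))
  (f_lin : forall e, 0 <= e < e0 -> scalar (f e))
  (u_sol : forall e, 0 <= e < e0 -> forall phi : W, a e (u e) phi = f e phi)
  (u_uniq : forall e, 0 <= e < e0 -> forall u' : V,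
     (forall phi : W, a e u' phi = f e phi) -> u' = u e)
  (u_sub : forall e, 0 <= e < e0 -> exists w : W, iW w = iV (u e - u 0))
  (J_diff : forall e, 0 <= e -> differentiable (J e) (u 0))
  (p_adj : forall e, 0 <= e < e0 -> forall phi : V,
     a e phi (p e) = - 'd (J e) (u 0) phi)
  (l1 : R -> R) (l1_gt0 : forall e, 0 < e -> 0 < l1 e)
  (l1_cvg : l1 e @[e --> 0^'+] --> 0)
  (R1 dL1 : R)
  (R1_lim : (lagrangian J a f e (u e) (p e) - lagrangian J a f e (u 0) (p e))
              / l1 e @[e --> 0^'+] --> R1)
  (dL1_lim : (lagrangian J a f e (u 0) (p e) - lagrangian J a f 0 (u 0) (p e))
              / l1 e @[e --> 0^'+] --> dL1) :
  ((* (i) *)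
   (forall e, reduced_cost J u e =
      (reduced_cost J u 0 + l1 e * (R1 + dL1)) +o_(e \near 0^'+) (l1 e)) /\
   (forall da df dJ1 dJ2 : R,
      (forall e, a e (u 0) (p e) - a 0 (u 0) (p e) =
         (l1 e * da) +o_(e \near 0^'+) (l1 e)) ->
      (forall e, f e (p e) - f 0 (p e) =
         (l1 e * df) +o_(e \near 0^'+) (l1 e)) ->
      (forall e, J e (u e) =
         (J e (u 0) + 'd (J e) (u 0) (u e - u 0) + l1 e * dJ1)
         +o_(e \near 0^'+) (l1 e)) ->
      (forall e, J e (u 0) =
         (J 0 (u 0) + l1 e * dJ2) +o_(e \near 0^'+) (l1 e)) ->
      R1 + dL1 = da - df + dJ1 + dJ2)) /\
  ((* (ii) *)
   forall (l2 : R -> R),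
     (forall e, 0 < e -> 0 < l2 e) ->
     l2 e / l1 e @[e --> 0^'+] --> 0 ->
   forall R2 dL2 : R,
     (lagrangian J a f e (u e) (p e) - lagrangian J a f e (u 0) (p e)
        - l1 e * R1) / l2 e @[e --> 0^'+] --> R2 ->
     (lagrangian J a f e (u 0) (p e) - lagrangian J a f 0 (u 0) (p e)
        - l1 e * dL1) / l2 e @[e --> 0^'+] --> dL2 ->
   forall e, reduced_cost J u e =
     (reduced_cost J u 0 + l1 e * (R1 + dL1) + l2 e * (R2 + dL2))
     +o_(e \near 0^'+) (l2 e)).
Proof.
have near_dom : \forall e \near 0^'+, 0 < e /\ 0 <= e < e0.
  near=> e.
  have e_gt0 : 0 < e by near: e; exact: nbhs_right_gt.
  by rewrite e_gt0 (ltW e_gt0); split=> //=; near: e; exact: nbhs_right_lt.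
have L_state e : 0 <= e < e0 -> lagrangian J a f e (u e) (p e) = J e (u e).
  by move=> e_dom; rewrite /lagrangian u_sol// addrK.
(* The state equation at parameter 0 is tested with [p e], so [e] needs no restriction. *)
have L_base e : lagrangian J a f 0 (u 0) (p e) = J 0 (u 0).
  by rewrite /lagrangian u_sol ?lexx// addrK.
(* The intermediate value L(e, u_0, p_e) telescopes in the sum of the two quotients. *)
have j1_lim : (J e (u e) - J 0 (u 0)) / l1 e @[e --> 0^'+] --> R1 + dL1.
  apply: cvg_trans (cvgD R1_lim dL1_lim); apply: near_eq_cvg.
  near=> e; have [_ e_dom] : 0 < e /\ 0 <= e < e0 by near: e.
  by rewrite fctE L_base L_state//; ring.
split; first split.
- by apply/eqaddo_scale_right_cvgP.
- move=> da df dJ1 dJ2 a_exp f_exp J1_exp J2_exp.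
  have a_lim := (cvg_right_div_subP _ _ _ _ l1_gt0).1
    ((eqaddo_right_cvgP _ _ _ _ l1_gt0).1 a_exp).
  have f_lim := (cvg_right_div_subP _ _ _ _ l1_gt0).1
    ((eqaddo_right_cvgP _ _ _ _ l1_gt0).1 f_exp).
  have J1_lim := (eqaddo_scale_right_cvgP _ _ _ _ _ l1_gt0).1 J1_exp.
  have J2_lim := (eqaddo_scale_right_cvgP _ _ _ _ _ l1_gt0).1 J2_exp.
  (* It remains to show that the quotient of [j1_lim] also tends to the sum of the four
     coefficients. *)
  apply: (norm_cvg_unique j1_lim).
  apply: cvg_trans (cvgD (cvgD (cvgB a_lim f_lim) J1_lim) J2_lim).
  apply: near_eq_cvg.
  near=> e; have [_ e_dom] : 0 < e /\ 0 <= e < e0 by near: e.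
  have e0_dom : 0 <= (0 : R) < e0 by rewrite lexx.
  (* The adjoint equation is tested with [u e - u 0]; linearity of [a e] in its first argument, with
     scalar -1, splits the result. *)
  have dJ_diff : 'd (J e) (u 0) (u e - u 0) = a e (u 0) (p e) - f e (p e).
    have := (a_bilin e e_dom).1 (p e) (-1) (u 0) (u e).
    by rewrite scaleN1r (addrC (- u 0)) p_adj// u_sol// => /(canRL opprK) -> /=; ring.
  (* The terms at [e] cancel by [dJ_diff], and those at 0 because a_0(u_0, p_e) = f_0(p_e). *)
  by rewrite !fctE dJ_diff (u_sol 0 e0_dom); ring.
- move=> l2 l2_gt0 _ R2 dL2 R2_lim dL2_lim.
  apply/eqaddo_scale_right_cvgP => //.
  (* The same telescoping, with the first-order terms adding up to [l1 e * (R1 + dL1)]. *)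
  apply: cvg_trans (cvgD R2_lim dL2_lim); apply: near_eq_cvg.
  near=> e; have [_ e_dom] : 0 < e /\ 0 <= e < e0 by near: e.
  by rewrite /reduced_cost fctE L_base L_state//; ring.
Unshelve. all: by end_near. Qed.
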